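(* For every integer $r\geq 2$ there exists $\Delta_0$ such that for each graph $G$ of maximum degree $\Delta\geq\Delta_0$ with minimum degree $\delta(G)\geq r+2$, $$\chi''_{a,r}(G)\leq \left\lceil\frac{\Delta}{\ln^4\Delta}\right\rceil \left(\lceil\ln^4\Delta\rceil+5\lceil\ln^3\Delta\rceil+2\right).$$ Hence, for every fixed integer $r\ge 2$ and all graphs $G$ of maximum degree $\Delta$ with $\delta(G)\geq r+2$, one has $\chi''_{a,r}(G) = (1+o(1))\Delta$, where the $o(1)$ term tends to $0$ as $\Delta\to\infty$ (uniformly over all such $G$).
   Context: Graphs are finite and simple. For a graph $G=(V,E)$, $\Delta(G)$ and $\delta(G)$ denote its maximum and minimum degrees, $E(v)$ is the set of edges incident with a vertex $v$, and $d(u,v)$ is the distance between $u$ and $v$ in $G$. A proper total colouring of $G$ with $k$ colours is a map $c:E\cup V\to\{1,2,\ldots,k\}$ such that no two adjacent vertices get the same colour, no two edges sharing an endpoint get the same colour, and no edge gets the same colour as one of its endpoints. The pallet of a vertex $v$ under $c$ is $S_c(v):=\{c(e):e\in E(v)\}\cup\{c(v)\}$. For a positive integer $r$, vertices $u,v$ are $r$-neighbours if $1\leq d(u,v)\leq r$. The $r$-distant set distinguishing total number $\chi''_{a,r}(G)$ is the least $k$ for which there is a proper total colouring $c$ of $G$ with $k$ colours such that $S_c(u)\neq S_c(v)$ for every pair of $r$-neighbours $u,v\in V$. Notation: $\ln^j\Delta=(\ln\Delta)^j$. *)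

(* Defs.v *)
From HB Require Import structures.
From mathcomp Require Import all_boot all_order all_algebra.
From mathcomp Require Import all_classical all_reals all_analysis.

Set Implicit Arguments.
Unset Strict Implicit.
Unset Printing Implicit Defensive.

Record sgraph := SGraph {
  vertex :> finType;
  adj : rel vertex;
  adj_sym : symmetric adj;
  adj_irrefl : irreflexive adj }.

Section Graph.
Variable G : sgraph.

Definition deg (v : G) : nat := #|[set u | adj v u]|.

Definition maxdeg : nat := \max_(v : G) deg v.

(* Every degree is at most #|G|, so the unit #|G| of the big operator does not
   affect the minimum; the graph without vertices gets minimum degree 0. *)
Definition mindeg : nat := \big[minn/#|G|]_(v : G) deg v.

Definition edge_set : {set {set G}} :=
  [set A | [exists u : G, exists v : G, adj u v && (A == [set u; v])]].

Definition edge : finType := {A : {set G} | A \in edge_set}.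

Definition incident (v : G) : {set edge} := [set f : edge | v \in val f].

Definition walk (n : nat) (u v : G) : bool :=
  [exists p : n.-tuple G, path (@adj G) u p && (last u p == v)].

(* None stands for infinite distance. *)
Definition dist (u v : G) : option nat :=
  if pselect (exists n, walk n u v) is left ex then Some (ex_minn ex) else None.

Definition rneighbours (r : nat) (u v : G) : bool :=
  if dist u v is Some d then (1 <= d <= r)%N else false.

Section Colouring.
Variables (k : nat) (c : {ffun edge + G -> 'I_k}).

Definition proper_total_colouring : bool :=
  [&& [forall u : G, forall v : G, adj u v ==> (c (inr u) != c (inr v))],
      [forall f : edge, forall g : edge,
         (f != g) && [exists v : G, (f \in incident v) && (g \in incident v)]
           ==> (c (inl f) != c (inl g))]
    & [forall f : edge, forall v : G,
         (f \in incident v) ==> (c (inl f) != c (inr v))]].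

Definition pallet (v : G) : {set 'I_k} :=
  [set c (inl f) | f in incident v] :|: [set c (inr v)].

Definition set_distinguishing (r : nat) : bool :=
  [forall u : G, forall v : G, rneighbours r u v ==> (pallet u != pallet v)].

End Colouring.

Definition distinguishably_colourable (r k : nat) : bool :=
  [exists c : {ffun edge + G -> 'I_k},
     proper_total_colouring c && set_distinguishing c r].

Lemma dist_refl (u : G) : dist u u = Some 0.
Proof.
have w0 : walk 0 u u by apply/existsP; exists [tuple]; rewrite /= eqxx.
rewrite /dist; case: pselect => [ex|]; last by case; exists 0.
by case: ex_minnP => n _ /(_ 0 w0); rewrite leqn0 => /eqP ->.
Qed.

(* Giving all vertices and edges different colours always works. *)
Lemma ex_distinguishing_colouring (r : nat) :
  exists k, distinguishably_colourable r k.
Proof.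
exists #|{: edge + G}|; apply/existsP; exists [ffun x => enum_rank x].
have inj (x y : edge + G) : enum_rank x = enum_rank y -> x = y.
  exact: enum_rank_inj.
apply/andP; split.
  apply/and3P; split; apply/'forall_forallP => x y; apply/implyP => h;
    rewrite !ffunE; apply/eqP => /inj //.
    by case=> exy; move: h; rewrite exy adj_irrefl.
  by case=> exy; move: h; rewrite exy eqxx.
apply/'forall_forallP => u v; apply/implyP => huv; apply/eqP => e.
have uv : u != v.
  by apply/eqP => euv; move: huv; rewrite euv /rneighbours dist_refl.
have : enum_rank (inr u : edge + G)
         \in pallet [ffun x : edge + G => enum_rank x] v.
  by rewrite -e inE inE ffunE eqxx orbT.
rewrite inE => /orP[/imsetP[f _]|]; first by rewrite ffunE => /inj.
by rewrite inE ffunE => /eqP/inj [] /eqP; apply/negP.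
Qed.

Definition chi_total (r : nat) : nat :=
  ex_minn (ex_distinguishing_colouring r).

End Graph.

(* Main.v *)
(* Write L = ln Delta and split the palette into about Delta / L^4 classes of
   L^4 + 5 L^3 + 2 colours.  The vertices are coloured greedily from the whole
   palette.  Each edge then picks, uniformly and independently, a class
   different from those of its two ends, so that no edge can ever conflict with
   its ends.  By the local lemma one can choose so that
   - no class has more than L^4 + 5 L^3 + 1 edges at a vertex, whence Vizing's
     theorem colours the edges of every class with the colours of that class;
   - any two r-neighbours see a different number of colours of some class, and
     then their pallets differ whatever the colourings inside the classes.
   Revealing all but s of the edges at u which are not at v shows that the
   second event fails for u and v with probability at most s! / N^s, where N is
   the number of classes an edge chooses from.  One may take s = r + 2 for each
   of the O(Delta^r) nonadjacent r-neighbours, but only s = r + 1 for the at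
   most Delta adjacent ones; this is where minimum degree r + 2 is needed. *)
Require Import Defs.
From HB Require Import structures.
From mathcomp Require Import all_boot all_order all_algebra.
From mathcomp Require Import all_classical all_reals all_analysis.
From mathcomp Require Import all_fingroup zify ring lra.
Import mathcomp.boot.fintype mathcomp.boot.finset.
Import Order.TTheory GRing.Theory Num.Theory.

Set Implicit Arguments.
Unset Strict Implicit.
Unset Printing Implicit Defensive.

(** * Vizing's theorem *)

Section Vizing.
Variables (V K : finType).
Implicit Types (H : rel V) (s : K -> V -> V) (C N : {set V}) (J : {set K}).

(* A colour class is a matching, encoded as the involution [s i] exchanging the
   ends of its edges; its fixed points are the vertices missing colour [i]. *)
Definition edge_colouring H s :=
  [/\ forall i, involutive (s i),
      forall i j x, s i x = s j x -> s i x != x -> i = j,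
      forall i x, s i x != x -> H x (s i x) &
      forall x y, H x y -> exists i, s i x = y].

(** The Kempe change exchanging the colours [i] and [j] on [C], meant for [C] a union of [i]/[j]
    chains. For every other [k] the transposition is trivial and the two branches agree. *)
Definition kempe C i j s k x := if x \in C then s (tperm i j k) x else s k x.

Lemma kempe_colouring H s C i j :
    {in C, forall x, s i x \in C} -> {in C, forall x, s j x \in C} ->
  edge_colouring H s -> edge_colouring H (kempe C i j s).
Proof.
move=> Ci Cj [inv inj sub cov].
have stable k x : s k x \in C = (x \in C) \/ tperm i j k = k.
  have closedE l : {in C, forall x, s l x \in C} -> s l x \in C = (x \in C).
    by move=> Cl; apply/idP/idP => /Cl //; rewrite inv.
  by case: tpermP => [->|->|_ _]; [left; exact: closedE | left; exact: closedE | right].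
have stable' k x : x \in C -> s (tperm i j k) x \in C \/ tperm i j k = k.
  move=> xC; case: tpermP => [_|_|]; [left; exact: Cj | left; exact: Ci | by right].
split.
- move=> k x; rewrite /kempe; case: (boolP (x \in C)) => xC.
    case: (stable' k x xC) => [->|e]; first by rewrite inv.
    by rewrite e inv if_same.
  case: (stable k x) => [->|->]; first by rewrite (negPf xC) inv.
  by rewrite inv if_same.
- move=> k l x; rewrite /kempe; case: ifP => _; last exact: inj.
  by move=> e /(inj _ _ _ e) /perm_inj.
- by move=> k x; rewrite /kempe; case: ifP => _; apply: sub.
- move=> x y /cov[k <-]; exists (if x \in C then tperm i j k else k).
  by rewrite /kempe; case: (x \in C); rewrite ?tpermK.
Qed.

(** [C] is the orbit of [x] under [t], the composite of [a] and [b]. Since [a] fixes [x], it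
    reverses the orbit, sending the [n]-th iterate to the [-n]-th. A fixed point of [a] at position
    [n] thus gives [iter (n + n) t x = x], so [n] is 0 or half the order of the orbit. *)
Lemma kempe_chain (a b : V -> V) x :
    involutive a -> involutive b -> a x = x ->
  exists C, [/\ x \in C, {in C, forall y, a y \in C}, {in C, forall y, b y \in C} &
    #|[set y in C | a y == y]| <= 2].
Proof.
move=> aK bK ax; pose t y := a (b y).
have t_inj : injective t by move=> y z /(inv_inj aK) /(inv_inj bK).
have taK z : t (a (t z)) = a z by rewrite /t aK bK.
have iter_a n : iter n t (a (iter n t x)) = x.
  by elim: n => //= n IH; rewrite -iterS iterSr taK.
exists [set y | fconnect t x y].
have closed_a y : fconnect t x y -> fconnect t x (a y).
  move/iter_findex; move: (findex _ _ _) => n <-.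
  by rewrite fconnect_sym //; rewrite -{2}(iter_a n) fconnect_iter.
split.
- by rewrite inE connect0.
- by move=> y; rewrite !inE; exact: closed_a.
- move=> y; rewrite !inE => xy; rewrite -[b y]aK; apply: closed_a.
  exact: connect_trans xy (fconnect1 t y).
set o := fingraph.order t x.
have no_return n : 0 < n < o -> iter n t x <> x.
  case/andP=> n0 no e; have := findex_iter no.
  by rewrite e findex0 => en; rewrite -en in n0.
suff sub : [set y in [set y | fconnect t x y] | a y == y]
    \subset [set x; iter o./2 t x].
  by rewrite (leq_trans (subset_leq_card sub)) // cards2; case: (x != _).
apply/subsetP => y; rewrite !inE => /andP[xy /eqP ay].
have := findex_max xy; have := iter_findex xy; rewrite -/o.
move: (findex _ _ _) => n yE no; rewrite -yE in ay *.
have := iter_a n; rewrite ay -iterD => ret.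
case: (posnP n) => [->|n0]; first by rewrite eqxx.
have [lt_nn|gt_nn|e] := ltngtP (n + n) o.
- by case: (no_return (n + n)) => //; rewrite lt_nn addn_gt0 n0.
- case: (no_return (n + n - o)); first by lia.
  by rewrite -{2}ret -{2}(subnK (ltnW gt_nn)) iterD (iter_order t_inj).
- by rewrite -e addnn doubleK eqxx orbT.
Qed.

Definition owners N (A : V -> {set K}) i := [set u in N | i \in A u].

(* Schrijver's induction: [N] is the neighbourhood of a new vertex and [A u] a
   set of colours missing at [u], of size 2 except for one vertex [w].  A colour
   owned by a single vertex can be given to it.  If there is none, then, as the
   number of pairs (owner, colour) is odd and less than [2 * #|J|], some colour
   has no owner and another at least three; a Kempe change on a chain containing
   one or two of those owners decreases the sum of squares. *)
Lemma missing_transversal_step H n s J N (A : V -> {set K}) w :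
    edge_colouring H s -> #|N| <= #|J| -> w \in N ->
    {in N, forall u, #|A u| = (u != w).+1} ->
    {in N, forall u, A u \subset J} ->
    {in N, forall u, {in A u, forall i, s i u = u}} ->
    \sum_(i in J) #|owners N A i| ^ 2 <= n ->
  exists s' a, [/\ edge_colouring H s', forall k, k \notin J -> s' k =1 s k,
    {in N &, injective a} & {in N, forall u, a u \in J /\ s' (a u) u = u}].
Proof.
elim: n s J N A w => [|n IH] s J N A w col leNJ wN cardA subA missA.
  (* The sum of squares cannot be 0: [A w] contains a colour, and [w] owns it. *)
  rewrite leqn0 sum_nat_eq0 => /forall_inP z.
  have /card_gt0P[i iA] : 0 < #|A w| by rewrite cardA.
  have iJ : i \in J := subsetP (subA w wN) i iA.
  have := z i iJ; rewrite expn_eq0 andbT cards_eq0 => /eqP/setP/(_ w).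
  by rewrite !inE wN iA.
move=> le_n.
case: (pickP [pred i | (i \in J) && (#|owners N A i| == 1)]) => [i|none].
  case/andP=> iJ /cards1P[u Xu].
  have ownu z : z \in N -> (i \in A z) = (z == u).
    by move=> zN; move/setP: Xu => /(_ z); rewrite !inE zN.
  have uN : u \in N by move: (set11 u); rewrite -Xu inE => /andP[].
  have miss_u : s i u = u by apply: missA; rewrite ?ownu.
  pose N' := N :\ u; pose J' := J :\ i.
  (* The recursive call changes no colour outside [J'], so [i] is still missing at [u] afterwards
     and can be assigned to it. *)
  have concl : (exists s' a, [/\ edge_colouring H s', forall k, k \notin J' -> s' k =1 s k,
    {in N' &, injective a} & {in N', forall u, a u \in J' /\ s' (a u) u = u}]) ->
    exists s' a, [/\ edge_colouring H s', forall k, k \notin J -> s' k =1 s k,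
    {in N &, injective a} & {in N, forall u, a u \in J /\ s' (a u) u = u}].
    case=> s' [a [col' agree inj aJ]].
    exists s', (fun z => if z == u then i else a z); split=> //.
    - by move=> k kJ; apply: agree; rewrite !inE negb_and kJ orbT.
    - have a_i z : z \in N -> z != u -> a z != i.
        move=> zN zu; have /aJ[] : z \in N' by rewrite !inE zu.
        by rewrite !inE => /andP[].
      move=> y z yN zN; case: eqP => [->|/eqP yu]; case: eqP => [->|/eqP zu] //.
      + by move/esym/eqP; rewrite (negPf (a_i z zN zu)).
      + by move/eqP; rewrite (negPf (a_i y yN yu)).
      + by apply: inj; rewrite !inE ?yu ?zu.
    - move=> z zN; case: eqP => [->|/eqP zu].
        by split=> //; rewrite agree // !inE eqxx.
      have /aJ[] : z \in N' by rewrite !inE zu.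
      by rewrite !inE => /andP[].
  apply: concl.
  have leNJ' : #|N'| <= #|J'|.
    by move: leNJ; rewrite (cardsD1 u N) uN (cardsD1 i J) iJ.
  (* Dropping [i] removes a term equal to 1, and shrinking the sets can only decrease the others. *)
  have reduce (A' : V -> {set K}) : (forall z, A' z \subset A z) ->
      \sum_(k in J') #|owners N' A' k| ^ 2 <= n.
    move=> sA'; rewrite -ltnS; apply: leq_trans le_n.
    rewrite (big_setD1 i iJ) /= Xu cards1 -/J' add1n ltnS; apply: leq_sum => k _.
    rewrite leq_exp2r // subset_leq_card //; apply/subsetP => z; rewrite !inE.
    by case/andP=> /andP[_ ->] /(subsetP (sA' z)).
  have sub' z : z \in N' -> A z \subset J'.
    rewrite !inE => /andP[zu zN]; apply/subsetP => k kA; rewrite !inE.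
    rewrite (subsetP (subA z zN) k kA) andbT; apply: contraNneq zu => ki.
    by rewrite -ownu // -ki.
  case: (set_0Vmem N') => [N'0|[w' w'N]].
    by exists s, (fun=> i); split=> // z; rewrite N'0 inE.
  (* If the exceptional vertex [w] itself is removed, another vertex [w'] gives up one colour and
     becomes the exceptional one. *)
  case: (eqVneq u w) => [uw|uw].
    have /andP[w'w w'N0] : (w' != w) && (w' \in N) by rewrite -uw; move: w'N; rewrite !inE.
    have /card_gt0P[k kA] : 0 < #|A w'| by rewrite cardA.
    pose A' z := if z == w' then A z :\ k else A z.
    have sA' z : A' z \subset A z by rewrite /A'; case: ifP => // _; exact: subsetDl.
    apply: (IH s J' N' A' w') => //; last exact: reduce.
    - move=> z; rewrite !inE => /andP[zu zN]; rewrite /A'; case: eqP => [->|_].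
        have := cardA w' w'N0; rewrite w'w (cardsD1 k) kA add1n => -[->] //.
      by rewrite cardA // -uw zu.
    - by move=> z zN'; apply: subset_trans (sA' z) (sub' z zN').
    - move=> z; rewrite !inE => /andP[_ zN] l /(subsetP (sA' z)); exact: missA.
  apply: (IH s J' N' A w) => //; last exact: reduce.
  - by rewrite !inE eq_sym uw.
  - by move=> z; rewrite !inE => /andP[_ zN]; exact: cardA.
  - by move=> z; rewrite !inE => /andP[_ zN]; exact: missA.
have sumX : \sum_(i in J) #|owners N A i| = (#|N|.-1.*2).+1.
  transitivity (\sum_(u in N) #|A u|).
    have -> : \sum_(i in J) #|owners N A i| = \sum_(i in J) \sum_(u in N) (i \in A u).
      apply: eq_bigr => i _; rewrite -sum1_card big_mkcond [RHS]big_mkcond.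
      by apply: eq_bigr => u _; rewrite !inE; case: (u \in N) (i \in A u) => [] [].
    rewrite exchange_big; apply: eq_bigr => u uN.
    rewrite -sum1_card big_mkcond [RHS]big_mkcond; apply: eq_bigr => i _.
    by case: (boolP (i \in A u)) => [/(subsetP (subA u uN)) ->|_] //; case: ifP.
  rewrite (big_setD1 w wN) /= (cardA w wN) eqxx.
  rewrite (eq_bigr (fun=> 2)) => [|u]; last first.
    by rewrite !inE => /andP[uw uN]; rewrite cardA // uw.
  by rewrite sum_nat_const (cardsD1 w N) wN /= add1n muln2.
have N0 : 0 < #|N| by apply/card_gt0P; exists w.
(* Otherwise every colour has at least two owners, and the sum is at least [2 * #|J|]. *)
have [j jJ Xj0] : exists2 j, j \in J & owners N A j = set0.
  apply/'exists_in_eqP; apply: contraT => /exists_inPn noj.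
  have : \sum_(i in J) 2 <= \sum_(i in J) #|owners N A i|.
    apply: leq_sum => i iJ; have := none i; rewrite /= iJ /=.
    have := noj i iJ; rewrite -cards_eq0.
    by case: #|_| => [|[|]].
  by rewrite sumX sum_nat_const; move: N0 leNJ; lia.
(* Otherwise every colour has 0 or 2 owners, and the sum is even. *)
have [i iJ Xi3] : exists2 i, i \in J & 2 < #|owners N A i|.
  apply/exists_inP; apply: contraT => /exists_inPn noi.
  have : odd (\sum_(i in J) #|owners N A i|) by rewrite sumX /= odd_double.
  apply: contraTT => _; elim/big_ind: _ => // [p q /negPf op /negPf oq|k kJ].
    by rewrite oddD op oq.
  have := none k; have := noi k kJ; rewrite /= kJ /=.
  by case: #|_| => [|[|[|]]].
have ij : i != j.
  by apply: contraTneq Xi3 => ->; rewrite Xj0 cards0.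
have /card_gt0P[x] : 0 < #|owners N A i| by apply: leq_ltn_trans Xi3.
rewrite inE => /andP[xN xA].
have [C [xC Ci Cj leC]] :=
  kempe_chain (let: And4 inv _ _ _ := col in inv i)
    (let: And4 inv _ _ _ := col in inv j) (missA x xN i xA).
pose A' u := if u \in C then [set k | tperm i j k \in A u] else A u.
case: (IH (kempe C i j s) J N A' w) => //.
- exact: kempe_colouring.
- move=> u uN; rewrite -cardA // /A'; case: ifP => // _.
  rewrite -(card_imset (A u) (@perm_inj _ (tperm i j))); apply: eq_card => k.
  rewrite inE; apply/idP/imsetP => [kA|[l lA ->]]; last by rewrite tpermK.
  by exists (tperm i j k); rewrite ?tpermK.
- move=> u uN; rewrite /A'; case: ifP => _; last exact: subA.
  apply/subsetP => k; rewrite inE; case: tpermP => [-> _|-> _|_ _] //.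
  exact/subsetP/subA.
- move=> u uN k; rewrite /A' /kempe; case: ifP => _; last exact: missA.
  by rewrite inE; apply: missA.
- have noj u : u \in N -> (j \in A u) = false.
    by move=> uN; move/setP: Xj0 => /(_ u); rewrite !inE uN.
  rewrite -ltnS; apply: leq_trans le_n.
  have jJ' : j \in J :\ i by rewrite !inE eq_sym ij.
  rewrite !(big_setD1 i iJ) /= !(big_setD1 j jJ') /= Xj0 cards0.
  have -> : owners N A' i = owners N A i :\: C.
    apply/setP => u; rewrite !inE /A'; case: (boolP (u \in N)) => uN /=; last by rewrite andbF.
    by case: ifP => _; rewrite ?inE ?tpermL ?noj.
  have -> : owners N A' j = owners N A i :&: C.
    apply/setP => u; rewrite !inE /A'; case: (boolP (u \in N)) => uN //=.
    by case: ifP => _; rewrite ?inE ?tpermR ?noj // ?andbT ?andbF.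
  have -> : \sum_(k in J :\ i :\ j) #|owners N A' k| ^ 2 =
      \sum_(k in J :\ i :\ j) #|owners N A k| ^ 2.
    apply: eq_bigr => k; rewrite !inE => /and3P[kj ki _]; congr (_ ^ 2).
    apply: eq_card => u; rewrite !inE /A'; case: ifP => // _.
    by rewrite inE tpermD // eq_sym.
  have t2 : #|owners N A i :&: C| <= 2.
    apply: leq_trans leC; apply: subset_leq_card; apply/subsetP => u.
    rewrite !inE => /andP[/andP[uN uA] ->] /=; apply/eqP; exact: missA.
  have t0 : 0 < #|owners N A i :&: C|.
    by apply/card_gt0P; exists x; rewrite !inE xN xA.
  (* The owners of [i] split into [p > 0] off the chain, which keep [i], and [q > 0] on it, which
     now own [j]; and [p^2 + q^2 < (p + q)^2]. *)
  rewrite addnA addnA ltn_add2r addn0.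
  move: Xi3 t2 t0; rewrite -(cardsID C (owners N A i)); nia.
move=> s' [a [col' agree inj aJ]]; exists s', a; split=> // k kJ u.
rewrite agree // /kempe; case: ifP => // _; case: tpermP => // e.
  by rewrite e iJ in kJ.
by rewrite e jJ in kJ.
Qed.

(** The sets [A u] are truncated to two colours, and to one at [w], to get the sizes required by the
    induction. *)
Lemma missing_transversal H s N (A : V -> {set K}) w :
    edge_colouring H s -> #|N| <= #|K| -> w \in N ->
    {in N, forall u, 1 < #|A u|} ->
    {in N, forall u, {in A u, forall i, s i u = u}} ->
  exists s' a, [/\ edge_colouring H s', {in N &, injective a} &
    {in N, forall u, s' (a u) u = u}].
Proof.
move=> col leNK wN cardA missA.
pose A' u := [set i in take (u != w).+1 (enum (A u))].
case: (@missing_transversal_step H (\sum_(i in [set: K]) #|owners N A' i| ^ 2)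
  s [set: K] N A' w) => //.
- by rewrite cardsT.
- move=> u uN; rewrite cardsE (card_uniqP _) ?take_uniq ?enum_uniq //.
  rewrite size_take -cardE; have := cardA u uN.
  by case: (u != w) => /=; case: #|A u| => [|[|[|m]]].
- by move=> u uN i; rewrite inE => /mem_take; rewrite mem_enum; apply: missA.
move=> s' [a [col' _ inj aJ]]; exists s', a; split=> // u /aJ[] //.
Qed.

(** Vertices are added one at a time. After a recolouring, the edges at the new vertex receive
    distinct colours, each missing at the other end. *)
Theorem vizing H :
    symmetric H -> irreflexive H ->
    (forall x, #|[set y | H x y]| < #|K|) ->
  exists s, edge_colouring H s.
Proof.
move=> Hsym Hirr degH.
pose HS (l : seq V) x y := [&& x \in l, y \in l & H x y].
suff step l : exists s, edge_colouring (HS l) s.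
  have [s [inv inj sub cov]] := step (enum V); exists s; split=> //.
    by move=> i x /sub /and3P[].
  by move=> x y xy; apply: cov; rewrite /HS !mem_enum.
elim: l => [|v l [s col]].
  by exists (fun _ x => x); split=> // [i j x _|i x]; rewrite eqxx.
have [vl|vl] := boolP (v \in l).
  exists s; case: col => inv inj sub cov; split=> // [i x /sub|x y].
    by rewrite /HS !inE => /and3P[-> -> ->]; rewrite !orbT.
  move=> xy; apply: cov; move: xy; rewrite /HS !inE.
  by case: eqP => [->|_]; case: eqP => [->|_]; rewrite ?vl.
pose N := [set u | (u \in l) && H v u].
have NP u : (u \in N) = (u \in l) && H v u by rewrite inE.
pose A u := [set i | s i u == u].
have [s' [a [[inv inj sub cov] a_inj miss_a]]] : exists s' a,
    [/\ edge_colouring (HS l) s', {in N &, injective a} & {in N, forall u, s' (a u) u = u}].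
  case: (set_0Vmem N) => [N0|[w wN]].
    have /card_gt0P[k _] : 0 < #|K| by apply: leq_ltn_trans (degH v).
    by exists s, (fun=> k); split=> // u; rewrite N0 inE.
  apply: (@missing_transversal _ s N A w) => //.
  - apply: leq_trans (ltnW (degH v)); apply: subset_leq_card.
    by apply/subsetP => u; rewrite !inE => /andP[].
  - move=> u uN; case: col => _ inj sub _.
    have uv : v \in [set y | H u y] by move: uN; rewrite !inE Hsym => /andP[].
    (* Each colour present at [u] leads to a neighbour other than [v], because the edge to [v] is
       still uncoloured. As [u] has degree less than [#|K|], at least two colours are missing. *)
    have : #|~: A u| <= #|[set y | H u y] :\ v|.
      rewrite -(@card_in_imset _ _ (fun i => s i u)).
        apply: subset_leq_card; apply/subsetP => y /imsetP[i]; rewrite !inE => /sub.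
        by case/and3P=> _ sl Hs ->; rewrite Hs andbT; apply: contraNneq vl => <-.
      by move=> i j; rewrite !inE => iu _ /inj; apply.
    by have := cardsC (A u); have := degH u; rewrite (cardsD1 v) uv /=; lia.
  - by move=> u uN i; rewrite inE => /eqP.
have sv i : s' i v = v.
  by apply/eqP; apply: contraNT vl => /sub /and3P[].
have s_v i x : s' i x = v -> x = v by move/(congr1 (s' i)); rewrite inv sv.
have Nv : v \notin N by rewrite NP negb_and vl.
(* The matching of colour [i] is enlarged by the edge from [v] to the vertex [u] of [N] with
   [a u = i]; if there is no such [u], then [v] stays a fixed point. *)
pose t i x := if x == v then odflt v [pick u in N | a u == i]
  else if (x \in N) && (a x == i) then v else s' i x.
have pick_a u : u \in N -> [pick z in N | a z == a u] = Some u.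
  move=> uN; case: pickP => [z /andP[zN /eqP /a_inj ->] //|/(_ u)].
  by rewrite uN eqxx.
have N_neqv u : u \in N -> (u == v) = false.
  by move=> uN; apply/negbTE; apply: contraNneq Nv => <-.
exists t; split.
- move=> i x; rewrite {2}/t; case: eqP => [->|/eqP xv].
    case: pickP => [u /andP[uN ua]|none] /=.
      by rewrite /t (N_neqv u uN) uN ua.
    by rewrite /t eqxx; case: pickP => // u; rewrite none.
  case: ifP => [/andP[xN /eqP xa]|xN].
    by rewrite /t eqxx -xa pick_a.
  rewrite /t inv; case: eqP => [/s_v/eqP|_]; first by rewrite (negPf xv).
  case: ifP => // /andP[yN /eqP ya].
  have := miss_a _ yN; rewrite ya inv => e; move: xN; by rewrite e yN ya eqxx.
- move=> i j x; rewrite /t; case: eqP => [->|/eqP xv].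
    case: pickP => [u /andP[uN /eqP <-]|_] /=; last by rewrite eqxx.
    by case: pickP => [z /andP[zN /eqP <-] /= ->|_ /= ->]; rewrite ?eqxx.
  case: ifP => [/andP[xN /eqP <-]|_].
    by case: ifP => [/andP[_ /eqP <-] //|_ /esym /s_v xv']; rewrite xv' eqxx in xv.
  case: ifP => [_ /s_v xv'|_]; [by rewrite xv' eqxx in xv | exact: inj].
- move=> i x; rewrite /t /HS; case: (eqVneq x v) => [->|xv].
    case: pickP => [u /andP[]|_] /=; last by rewrite eqxx.
    by rewrite NP !inE eqxx => /andP[-> ->] _ _; rewrite orbT.
  case: ifP => [/andP[]|_ /sub /and3P[xl yl Hxy]].
    by rewrite NP !inE eqxx Hsym => /andP[-> ->] _ _; rewrite orbT.
  by rewrite !inE xl yl Hxy !orbT.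
- move=> x y; rewrite /HS !inE; case: (eqVneq x v) => [->|xv] /=.
    case: (eqVneq y v) => [->|yv] /=; first by rewrite Hirr.
    move=> /andP[yl vy]; exists (a y).
    by rewrite /t eqxx pick_a // NP yl.
  case: (eqVneq y v) => [->|yv] /=.
    move=> /andP[xl xHv]; exists (a x).
    by rewrite /t (negPf xv) eqxx NP xl Hsym xHv.
  move=> xy; have [i e] := cov x y xy; exists i.
  rewrite /t (negPf xv); case: ifP => // /andP[xN /eqP xa].
  by move: xy; rewrite -e -xa miss_a // Hirr !andbF.
Qed.

End Vizing.

(** * Distances, edges and colourings by classes *)

Lemma card_bigcup_le (I T : finType) (P : pred I) (F : I -> {set T}) :
  #|\bigcup_(i | P i) F i| <= \sum_(i | P i) #|F i|.
Proof.
elim/big_rec2: _ => [|i n U _ le]; first by rewrite cards0.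
by rewrite cardsU; apply: leq_trans (leq_subr _ _) _; rewrite leq_add2l.
Qed.

Section Graph.
Variable G : sgraph.
Implicit Types (u v w : G) (e f : edge G).

Lemma adj_neq u v : adj u v -> u != v.
Proof. by apply: contraTneq => ->; rewrite adj_irrefl. Qed.

Lemma edgeP e : exists u v, adj u v /\ val e = [set u; v].
Proof.
by case: e => A /= ; rewrite inE => /existsP[u /existsP[v /andP[uv /eqP ->]]]; exists u, v.
Qed.

Lemma edge_other_end e v : v \in val e -> exists2 u, adj v u & val e = [set v; u].
Proof.
have [x [y [xy ->]]] := edgeP e; rewrite !inE => /orP[]/eqP->; first by exists y.
by exists x; rewrite 1?adj_sym // setUC.
Qed.

Lemma adj_edge u v : adj u v -> exists e, val e = [set u; v].
Proof.
move=> uv; have euv : [set u; v] \in edge_set G.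
  by rewrite inE; apply/existsP; exists u; apply/existsP; exists v; rewrite uv eqxx.
by exists (Sub [set u; v] euv); rewrite SubK.
Qed.

Lemma set2_inj v u w : u != v -> [set v; u] = [set v; w] -> u = w.
Proof.
move=> uv /setP/(_ u); rewrite !inE eqxx orbT (negPf uv) /=.
by move/esym/eqP.
Qed.

Lemma edge_endsP e u v : u != v -> u \in val e -> v \in val e -> val e = [set u; v].
Proof.
move=> uv /edge_other_end[w _ ->]; rewrite !inE eq_sym (negPf uv) /=.
by move=> /eqP ->.
Qed.

Lemma card_incident v : #|incident v| = deg v.
Proof.
rewrite /deg -(card_imset _ val_inj) -(@card_in_imset _ _ (fun u => [set v; u])).
  apply: eq_card => A; apply/imsetP/imsetP => [[e]|[u]]; rewrite !inE.
    by move=> /edge_other_end[u vu ->] ->; exists u; rewrite ?inE.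
  by move=> /adj_edge[e eE] ->; exists e; rewrite // inE eE !inE eqxx.
by move=> u w; rewrite !inE => /adj_neq vu _; apply: set2_inj; rewrite eq_sym.
Qed.

Lemma card_incident2 u v : u != v -> #|incident u :&: incident v| <= adj u v.
Proof.
move=> uv; case: (boolP (adj u v)) => [_|nadj].
  apply/card_le1P => e; rewrite !inE => /andP[eu ev] f; rewrite !inE.
  apply/idP/eqP => [/andP[fu fv]|->]; last by rewrite eu ev.
  by apply: val_inj; rewrite /= (edge_endsP uv eu ev) (edge_endsP uv fu fv).
rewrite leqn0 cards_eq0; apply/eqP/setP => e; rewrite !inE.
apply: contraNF nadj => /andP[/edge_other_end[w uw ->]].
by rewrite !inE eq_sym (negPf uv) /= => /eqP ->.
Qed.

Lemma card_edge e : #|val e| = 2.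
Proof. by have [u [v [/adj_neq uv ->]]] := edgeP e; rewrite cards2 uv. Qed.

Lemma leq_maxdeg v : deg v <= maxdeg G.
Proof. exact: leq_bigmax. Qed.

Lemma mindeg_leq v : mindeg G <= deg v.
Proof.
rewrite /mindeg; elim: (index_enum _) (mem_index_enum v) => // u l IH.
by rewrite inE big_cons geq_min => /predU1P[->|/IH ->]; rewrite ?leqnn ?orbT.
Qed.

Lemma walkS n u v : walk n.+1 u v -> exists2 w, adj u w & walk n w v.
Proof.
case/existsP => p /andP[]; case/tupleP: p => w p /= /andP[uw wp] pv.
by exists w => //; apply/existsP; exists p; rewrite wp.
Qed.

Lemma walk_sym n u v : walk n u v -> walk n v u.
Proof.
case/existsP => p /andP[up /eqP <-]; apply/existsP.
exists (rev_tuple (belast_tuple u p)); rewrite /=.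
rewrite rev_path (eq_path (e' := @adj G)) ?up; last by move=> x y; rewrite adj_sym.
case: (tval p) => [|y q] /=; first by rewrite eqxx.
by rewrite rev_cons last_rcons.
Qed.

Lemma card_walk n u : #|[set v | walk n u v]| <= maxdeg G ^ n.
Proof.
elim: n u => [|n IH] u.
  apply: (@leq_trans #|[set u]|); last by rewrite cards1.
  apply/subset_leq_card/subsetP => v; rewrite !inE => /existsP[p].
  by rewrite tuple0 /= eq_sym.
apply: (@leq_trans #|\bigcup_(w in [set w | adj u w]) [set v | walk n w v]|).
  apply: subset_leq_card; apply/subsetP => v; rewrite inE => /walkS[w uw wv].
  by apply/bigcupP; exists w; rewrite inE.
apply: leq_trans (card_bigcup_le _ _) _.
apply: (@leq_trans (\sum_(w in [set w | adj u w]) maxdeg G ^ n)).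
  by apply: leq_sum => w _; apply: IH.
by rewrite sum_nat_const expnS leq_mul2r leq_maxdeg orbT.
Qed.

(** A relaxation of [rneighbours] that forgets the minimality of the length, which makes symmetry
    and counting easy. *)
Definition within_dist r u v := [exists n : 'I_r, walk n.+1 u v].

Lemma rneighbours_within_dist r u v : rneighbours r u v -> u != v /\ within_dist r u v.
Proof.
move=> uv; split.
  by apply: contraTneq uv => ->; rewrite /rneighbours dist_refl.
move: uv; rewrite /rneighbours /dist; case: pselect => // ex.
case: ex_minnP => -[|n] // wn _ /= nr.
by apply/existsP; exists (Ordinal nr).
Qed.

Lemma within_dist_sym r u v : within_dist r u v = within_dist r v u.
Proof. by apply: eq_existsb => n; apply/idP/idP; exact: walk_sym. Qed.

Lemma card_within_dist r u : 0 < maxdeg G -> #|[set v | within_dist r u v]| <= r * maxdeg G ^ r.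
Proof.
move=> D0; apply: (@leq_trans #|\bigcup_(n < r) [set v | walk n.+1 u v]|).
  apply: subset_leq_card; apply/subsetP => v; rewrite inE => /existsP[n wn].
  by apply/bigcupP; exists n; rewrite ?inE.
apply: leq_trans (card_bigcup_le _ _) _.
apply: (@leq_trans (\sum_(n < r) maxdeg G ^ r)); last by rewrite sum_nat_const card_ord.
by apply: leq_sum => n _; apply: leq_trans (card_walk _ _) _; rewrite leq_pexp2l.
Qed.

Lemma vertex_colouring (T : finType) : maxdeg G < #|T| ->
  exists c : G -> T, forall u v, adj u v -> c u != c v.
Proof.
move=> ltT.
suff H (l : seq G) : exists c : G -> T,
    {in l &, forall u v, adj u v -> c u != c v}.
  by have [c cP] := H (enum G); exists c => u v; apply: cP; rewrite mem_enum.
elim: l => [|v l [c cP]].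
  have /card_gt0P[t _] : 0 < #|T| by apply: leq_ltn_trans ltT.
  by exists (fun=> t).
(* [t] avoids the values at all neighbours of [v], including those not yet treated: the degree bound
   allows it. *)
have [t tP] : exists t, t \notin c @: [set u | adj v u].
  apply/existsP; apply: contraTT ltT => /existsPn all_t; rewrite -leqNgt.
  apply: leq_trans (leq_maxdeg v); apply: leq_trans (leq_imset_card c _).
  by apply: subset_leq_card; apply/subsetP => t _; have := all_t t; rewrite negbK.
have tP' u : adj v u -> c u != t.
  by move=> vu; apply: contraNneq tP => <-; apply: imset_f; rewrite inE.
exists (fun u => if u == v then t else c u) => u w; rewrite !inE.
case: (eqVneq u v) => [->|uv] /=; case: (eqVneq w v) => [->|wv] //=.
- by rewrite adj_irrefl.
- by move=> _ _ /tP'; rewrite eq_sym.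
- by move=> _ _; rewrite adj_sym => /tP'.
- exact: cP.
Qed.

(** Edges at a common vertex have different colours. This is the lower bound in the asymptotic
    statement. *)
Lemma maxdeg_le_chi_total r : maxdeg G <= chi_total G r.
Proof.
rewrite /chi_total; case: ex_minnP => k /existsP[c /andP[/and3P[_ proper _] _]] _.
apply/bigmax_leqP => v _; rewrite -card_incident -[k]card_ord.
apply: (@leq_card_in _ _ (fun e => c (inl e))) => e f ev fv ce.
apply: contraTeq proper => ef; apply/forallPn; exists e; apply/forallPn; exists f.
rewrite ef ce eqxx; have -> // : [exists w, (e \in incident w) && (f \in incident w)].
by apply/existsP; exists v; rewrite ev fv.
Qed.

(** Lets any finite type serve as the palette, so that colours can be pairs. *)
Lemma chi_total_le r (T : finType) (ce : edge G -> T) (cv : G -> T) :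
    (forall u v, adj u v -> cv u != cv v) ->
    (forall v, {in incident v &, injective ce}) ->
    (forall e v, e \in incident v -> ce e != cv v) ->
    (forall u v, rneighbours r u v ->
       ce @: incident u :|: [set cv u] != ce @: incident v :|: [set cv v]) ->
  chi_total G r <= #|T|.
Proof.
move=> vP eP evP dist_uv; rewrite /chi_total; case: ex_minnP => k _; apply.
pose c (x : edge G + G) := enum_rank (match x with inl e => ce e | inr v => cv v end).
apply/existsP; exists (finfun c); apply/andP; split; first (apply/and3P; split).
- apply/'forall_forallP => u v; apply/implyP => uv.
  by rewrite !ffunE (inj_eq enum_rank_inj) vP.
- apply/'forall_forallP => e f; apply/implyP => /andP[ef /existsP[v /andP[ev fv]]].
  by rewrite !ffunE (inj_eq enum_rank_inj) (inj_in_eq (eP v)).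
- apply/'forall_forallP => e v; apply/implyP => ev.
  by rewrite !ffunE (inj_eq enum_rank_inj) evP.
apply/'forall_forallP => u v; apply/implyP => /dist_uv; apply: contraNneq.
have palletE w : pallet (finfun c) w = enum_rank @: (ce @: incident w :|: [set cv w]).
  rewrite /pallet imsetU imset_set1 -imset_comp ffunE; congr (_ :|: _).
  by apply: eq_imset => e; rewrite ffunE.
by rewrite !palletE => /(imset_inj enum_rank_inj) ->.
Qed.

Definition class_at (M : nat) (cl : edge G -> 'I_M) v i :=
  #|[set e in incident v | cl e == i]|.

(** An edge gets the pair of its class and its colour in a Vizing colouring of that class. It
    differs from its ends already in the first component, so the pallet of [w] has exactly
    [class_at cl w i + ((cv w).1 == i)] colours of class [i], whatever the Vizing colourings are. *)
Lemma chi_total_le_classes r M K (cl : edge G -> 'I_M) (cv : G -> 'I_M * 'I_K) :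
    (forall u v, adj u v -> cv u != cv v) ->
    (forall e v, e \in incident v -> cl e != (cv v).1) ->
    (forall v i, class_at cl v i < K) ->
    (forall u v, rneighbours r u v -> exists i,
       class_at cl u i + ((cv u).1 == i) != class_at cl v i + ((cv v).1 == i)) ->
  chi_total G r <= M * K.
Proof.
move=> vP clP sizeP distP.
pose H i u v := [exists e : edge G, (val e == [set u; v]) && (cl e == i)].
have Hsym i : symmetric (H i).
  by move=> u v; apply: eq_existsb => e; rewrite setUC.
have Hneq i u v : H i u v -> u != v.
  case/existsP => e /andP[/eqP ee _]; have := card_edge e; rewrite ee cards2.
  by case: (u == v).
have Hirr i : irreflexive (H i).
  by move=> u; apply: contraTF (eqxx u) => /Hneq.
have [s sP] : {s : 'I_M -> 'I_K -> G -> G & forall i, edge_colouring (H i) (s i)}.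
  apply: (@choice _ _ (fun i si => edge_colouring (H i) si)) => i.
  apply: vizing => // u; rewrite card_ord; apply: leq_ltn_trans (sizeP u i).
  rewrite -(@card_in_imset _ _ (fun v => [set u; v])) => [|v w]; last first.
    by rewrite !inE => /Hneq uv _; apply: set2_inj; rewrite eq_sym.
  rewrite /class_at -[leqRHS](card_imset _ val_inj); apply: subset_leq_card.
  apply/subsetP => _ /imsetP[v + ->]; rewrite inE => /existsP[e /andP[/eqP ee ei]].
  by apply/imsetP; exists e; rewrite // !inE ei ee !inE eqxx.
have [j jP] : {j : edge G -> 'I_K & forall e, exists u v,
    val e = [set u; v] /\ s (cl e) (j e) u = v}.
  apply: (@choice _ _ (fun e j => exists u v, val e = [set u; v] /\ s (cl e) j u = v)) => e.
  have [u [v [_ ee]]] := edgeP e; have [_ _ _ cov] := sP (cl e).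
  have [|j sj] := cov u v; last by exists j, u, v.
  by apply/existsP; exists e; rewrite ee !eqxx.
have endsE e v : v \in val e -> val e = [set v; s (cl e) (j e) v].
  have [x [y [-> <-]]] := jP e; have [inv _ _ _] := sP (cl e).
  by rewrite !inE => /orP[]/eqP->; rewrite // inv setUC.
pose ce e := (cl e, j e).
have ce_inj v : {in incident v &, injective ce}.
  move=> e f; rewrite !inE => ev fv [clE jE]; apply: val_inj => /=.
  by rewrite (endsE e v ev) (endsE f v fv) clE jE.
have ce_cv e v : e \in incident v -> ce e != cv v.
  by move=> /clP; apply: contraNneq => <-.
have -> : M * K = #|{: 'I_M * 'I_K}| by rewrite card_prod !card_ord.
apply: (chi_total_le (ce := ce) (cv := cv)) => // u v /distP[i]; apply: contraNneq.
have countE w : #|[set t in ce @: incident w :|: [set cv w] | t.1 == i]| =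
    class_at cl w i + ((cv w).1 == i).
  have -> : [set t in ce @: incident w :|: [set cv w] | t.1 == i] =
      ce @: [set e in incident w | cl e == i] :|: [set t in [set cv w] | t.1 == i].
    apply/setP => t; rewrite !inE andb_orl; congr (_ || _).
    apply/andP/imsetP => [[/imsetP[e ew ->] ei]|[e]].
      by exists e; rewrite // inE ew.
    by rewrite inE => /andP[ew ei] ->; rewrite imset_f.
  rewrite cardsU card_in_imset => [|e f]; last first.
    by rewrite !inE => /andP[ew _] /andP[fw _]; apply: (ce_inj w); rewrite inE.
  have -> : [set t in [set cv w] | t.1 == i] = if (cv w).1 == i then [set cv w] else set0.
    by apply/setP => t; rewrite !inE; case: eqP => [->|/eqP ne]; case: ifP; rewrite ?inE ?eqxx // (negPf ne).
  rewrite /class_at; case: ifP => _; last by rewrite setI0 !cards0 subn0.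
  rewrite (_ : _ :&: _ = set0) ?cards0 ?cards1 ?subn0 //.
  apply/setP => t; rewrite !inE; apply/negP => /andP[/imsetP[e + ->]].
  by rewrite inE => /andP[ew _]; apply/negP; exact: ce_cv.
by move=> e; rewrite -!countE e.
Qed.

End Graph.

(** * The local lemma *)

Local Open Scope ring_scope.

Section LocalLemma.
Variables (R : realFieldType) (E C : finType).
Hypothesis C_gt0 : (0 < #|C|)%N.
Notation Omega := {ffun E -> C}.
Implicit Types (S : {set E}) (A B : {set Omega}).

Definition determined_by S A :=
  forall f g : Omega, {in S, f =1 g} -> (f \in A) = (g \in A).

(* Swapping the values of two colourings on [S] is an involution of
   [Omega * Omega] that maps [(A :&: B) * Omega] onto [A * B]. *)
Lemma card_independent S A B :
    determined_by S A -> determined_by (~: S) B ->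
  (#|A :&: B| * #|Omega| = #|A| * #|B|)%N.
Proof.
move=> dA dB; rewrite -[#|Omega|]cardsT -!cardsX.
pose mix (f g : Omega) : Omega := [ffun e => if e \in S then f e else g e].
pose swap (p : Omega * Omega) := (mix p.1 p.2, mix p.2 p.1).
have swapK : involutive swap.
  by case=> f g; rewrite /swap; congr (_, _); apply/ffunP => e; rewrite !ffunE /=; case: ifP => eS; rewrite ?ffunE ?eS.
rewrite -(card_imset _ (inv_inj swapK)); apply: eq_card => -[f g].
rewrite -[(f, g) in LHS]swapK mem_imset; last exact: inv_inj.
rewrite !inE /= andbT; congr andb.
  by apply: dA => e eS; rewrite ffunE eS.
by apply: dB => e; rewrite inE => /negPf eS; rewrite ffunE eS.
Qed.

Variables (I : finType) (S : I -> {set E}) (A : I -> {set Omega}).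

Definition pr B : R := #|B|%:R / #|Omega|%:R.

Hypothesis detA : forall i, determined_by (S i) (A i).
Hypothesis prA : forall i, pr (A i) <= 4^-1.
Hypothesis sum_prA :
  forall i, \sum_(j | ~~ [disjoint S i & S j]) pr (A j) <= 4^-1.

Let avoid (T : {set I}) := [set f | [forall j in T, f \notin A j]].

Let Omega_gt0 : 0 < #|Omega|%:R :> R.
Proof. by rewrite ltr0n card_ffun expn_gt0 C_gt0. Qed.

Let pr_ge0 B : 0 <= pr B.
Proof. by rewrite divr_ge0 // ler0n. Qed.

Let avoid_independent i (T : {set I}) :
    {in T, forall j, [disjoint S i & S j]} ->
  #|A i :&: avoid T|%:R = pr (A i) * #|avoid T|%:R.
Proof.
move=> disj; have detT : determined_by (~: S i) (avoid T).
  move=> f g fg; rewrite !inE; apply: eq_forallb_in => j jT; congr negb; apply: detA => e ej.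
  apply: fg; rewrite inE; apply: contraTN (ej) => ei.
  by rewrite (disjointFr (disj j jT)).
have /(congr1 (fun n => n%:R : R)) := card_independent (@detA i) detT.
rewrite !natrM => e; rewrite /pr mulrAC -e mulfK //.
exact: lt0r_neq0.
Qed.

(** Conditioning on [avoid T] at most doubles the probability of [A i]. Discarding the events [T1]
    whose scopes meet that of [A i] leaves an independent condition [avoid T2]. By induction, given
    [avoid T2], the events of [T1] have total probability at most twice 1/4, so [avoid T] makes up
    at least half of [avoid T2]. *)
Lemma avoid_conditional i (T : {set I}) :
  #|A i :&: avoid T|%:R <= 2 * pr (A i) * #|avoid T|%:R.
Proof.
have [n] := ubnP #|T|; elim: n T i => // n IH T i leTn.
pose T1 := [set j in T | ~~ [disjoint S i & S j]].
pose T2 := [set j in T | [disjoint S i & S j]].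
have sub2 : avoid T \subset avoid T2.
  apply/subsetP => f; rewrite !inE => /forall_inP H; apply/forall_inP => j.
  by rewrite inE => /andP[jT _]; exact: H.
have le1 : #|A i :&: avoid T|%:R <= pr (A i) * #|avoid T2|%:R.
  rewrite -avoid_independent; last by move=> j; rewrite inE => /andP[].
  by rewrite ler_nat subset_leq_card ?setIS.
have le2 : #|avoid T2|%:R <= #|avoid T|%:R + \sum_(j in T1) #|A j :&: avoid T2|%:R :> R.
  rewrite -natr_sum -natrD ler_nat.
  have sub : avoid T2 \subset avoid T :|: \bigcup_(j in T1) (A j :&: avoid T2).
    apply/subsetP => f f2; rewrite in_setU.
    have [//|] := boolP (f \in avoid T); rewrite inE => /forall_inPn[j jT fj].
    apply/bigcupP; exists j; last by rewrite inE f2 andbT; move: fj; rewrite negbK.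
    rewrite inE jT; apply: contra fj => disj.
    by move: f2; rewrite inE => /forall_inP; apply; rewrite inE jT.
  apply: leq_trans (subset_leq_card sub) _.
  rewrite cardsU; apply: leq_trans (leq_subr _ _) _; rewrite leq_add2l.
  exact: card_bigcup_le.
have le3 : \sum_(j in T1) #|A j :&: avoid T2|%:R <= 2^-1 * #|avoid T2|%:R :> R.
  apply: (@le_trans _ _ (\sum_(j in T1) 2 * pr (A j) * #|avoid T2|%:R)).
    apply: ler_sum => j; rewrite inE => /andP[jT jS]; apply: IH.
    rewrite -ltnS; apply: leq_trans leTn; rewrite ltnS; apply: proper_card; apply/properP; split.
      by apply/subsetP => k; rewrite inE => /andP[].
    by exists j; rewrite // inE jT.
  rewrite -mulr_suml ler_wpM2r ?ler0n // -mulr_sumr.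
  have : \sum_(j in T1) pr (A j) <= 4^-1; last by lra.
  apply: le_trans (sum_prA i).
  rewrite [leRHS](bigID (mem T)) /=.
  rewrite (eq_bigl (fun j => ~~ [disjoint S i & S j] && (j \in T))).
    by rewrite lerDl sumr_ge0.
  by move=> j; rewrite inE andbC.
have : pr (A i) * #|avoid T2|%:R <= pr (A i) * (2 * #|avoid T|%:R).
  by apply: ler_wpM2l => //; lra.
by lra.
Qed.

(** Events are excluded one at a time; by [avoid_conditional] each removes at most half of what is
    left. *)
Theorem local_lemma : exists f, forall i, f \notin A i.
Proof.
suff H (s : seq I) : 0 < #|avoid [set x in s]|%:R :> R.
  have := H (enum I); rewrite ltr0n => /card_gt0P[f].
  rewrite inE => /forall_inP fA; exists f => i; apply: fA.
  by rewrite inE mem_enum.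
elim: s => [|i s IH].
  rewrite (_ : avoid _ = [set: Omega]) ?cardsT //.
  by apply/setP => f; rewrite !inE; apply/forall_inP => j; rewrite inE.
have -> : avoid [set x in i :: s] = avoid [set x in s] :\: A i.
  apply/setP => f; rewrite !inE; apply/forall_inP/andP => [H|[fi /forall_inP H] j].
    split; first by apply: H; rewrite !inE eqxx.
    by apply/forall_inP => j; rewrite inE => js; apply: H; rewrite !inE js orbT.
  by rewrite !inE => /predU1P[->//|js]; apply: H; rewrite inE.
have := avoid_conditional i [set x in s].
have := cardsID (A i) (avoid [set x in s]); rewrite setIC.
move/(congr1 (fun n => n%:R : R)); rewrite natrD.
have : pr (A i) * #|avoid [set x in s]|%:R <= 4^-1 * #|avoid [set x in s]|%:R.
  by rewrite ler_wpM2r ?ler0n.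
by lra.
Qed.

End LocalLemma.

(** * Random classes *)

Lemma size_permutations_le (T : eqType) (s : seq T) :
  (size (permutations s) <= (size s)`!)%N.
Proof.
move sE : (size s) => n; elim: n s sE => [|n IH] s sE.
  by rewrite (size0nil sE).
rewrite (perm_size (permutationsE _)) ?sE // size_allpairs_dep sumnE big_map.
rewrite (@leq_trans (\sum_(x <- undup s) n`!)%N) //.
  rewrite big_seq [X in (_ <= X)%N]big_seq; apply: leq_sum => x.
  by rewrite mem_undup => xs; apply: IH; rewrite size_rem // sE.
rewrite big_const_seq count_predT iter_addn_0 mulnC factS leq_mul2r -sE.
by rewrite size_undup orbT.
Qed.

Section RandomClasses.
Variables (R : realFieldType) (E T K : finType) (phi : E -> T -> K).
Hypothesis T_gt0 : (0 < #|T|)%N.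
Hypothesis phi_inj : forall e, injective (phi e).
Notation Omega := {ffun E -> T}.
Implicit Types (f g : Omega) (X D : {set E}) (A : {set Omega}).

Definition class_size f D k := #|[set e in D | phi e (f e) == k]|.

(** The indicator of agreement is a product over [E], so the count factors, with factor [#|T|] on
    [X] and 1 elsewhere. *)
Lemma card_agree_off X f :
  #|[set g : Omega | [forall (e | e \notin X), g e == f e]]| = (#|T| ^ #|X|)%N.
Proof.
rewrite -sum1_card.
transitivity (\sum_(g : Omega) \prod_e ((e \in X) || (g e == f e)))%N.
  rewrite big_mkcond; apply: eq_bigr => g _; rewrite inE.
  case: ifPn => [/forall_inP H|/forall_inPn[e eX ge]].
    by rewrite big1 // => e _; case: (boolP (e \in X)) => //= /H ->.
  by rewrite (bigD1 e) //= (negPf eX) (negPf ge).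
rewrite -(bigA_distr_bigA (fun e c => (e \in X) || (c == f e) : nat)) /=.
rewrite (bigID (mem X)) /= [X in (_ * X)%N]big1 => [|e /negPf ->].
  rewrite muln1 (eq_bigr (fun=> #|T|)) ?prod_nat_const // => e ->.
  by rewrite sum1_card.
rewrite (bigD1 (f e)) //= eqxx big1 // => c /negPf ->; exact: erefl.
Qed.

(* The classes of the edges of [X] form a rearrangement of a fixed word once the
   rest of the colouring is known. *)
Lemma card_same_class_sizes A X :
    (forall f g, f \in A -> g \in A -> {in ~: X, f =1 g} ->
       forall k, class_size f X k = class_size g X k) ->
  (#|A| * #|T| ^ #|X| <= (#|X|)`! * #|Omega|)%N.
Proof.
move=> sameA.
have fiber g : (#|[set f in A | [forall (e | e \notin X), g e == f e]]| <= (#|X|)`!)%N.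
  set D := [set f in A | _]; case: (set_0Vmem D) => [->|[f0]]; first by rewrite cards0.
  rewrite inE => /andP[f0A /forall_inP f0g].
  pose word f := [seq phi e (f e) | e <- enum X].
  have sw : size (word f0) = #|X| by rewrite size_map -cardE.
  rewrite -sw; apply: leq_trans (size_permutations_le _).
  (* The word determines [f]: on [X] by injectivity of [phi e], and off [X] because [f] agrees with
     [g]. *)
  rewrite cardE -(size_map word); apply: uniq_leq_size.
    rewrite map_inj_in_uniq ?enum_uniq // => f f'; rewrite !mem_enum !inE.
    move=> /andP[_ /forall_inP fg] /andP[_ /forall_inP fg'] ww.
    apply/ffunP => e; case: (boolP (e \in X)) => eX.
      apply: (@phi_inj e); have /eq_in_map := ww; apply.
      by rewrite mem_enum.
    by rewrite -(eqP (fg e eX)) -(eqP (fg' e eX)).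
  move=> w /mapP[f]; rewrite mem_enum inE => /andP[fA /forall_inP fg] ->.
  rewrite mem_permutations; apply/allP => k _ /=.
  have countE h : count_mem k (word h) = class_size h X k.
    rewrite count_map /class_size cardE -size_filter /enum_mem -filter_predI.
    by congr size; apply: eq_filter => e; rewrite !inE andbC.
  rewrite !countE; apply/eqP; apply: sameA => // e; rewrite inE => eX.
  by rewrite -(eqP (fg e eX)) -(eqP (f0g e eX)).
(* Double counting of the pairs of an [f] in [A] and a [g] that agree off [X]: every [f] has
   [#|T| ^ #|X|] partners. *)
have -> : (#|A| * #|T| ^ #|X| =
    \sum_(g : Omega) #|[set f in A | [forall (e | e \notin X), g e == f e]]|)%N.
  rewrite -sum_nat_const.
  under eq_bigr => f _ do rewrite -(card_agree_off X f) -sum1_card big_mkcond.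
  rewrite exchange_big; apply: eq_bigr => g _.
  rewrite -sum1_card [RHS]big_mkcond [LHS]big_mkcond; apply: eq_bigr => f _.
  by rewrite !inE; case: (f \in A).
rewrite mulnC -sum_nat_const; exact: leq_sum.
Qed.

Lemma pr_same_class_sizes A X :
    (forall f g, f \in A -> g \in A -> {in ~: X, f =1 g} ->
       forall k, class_size f X k = class_size g X k) ->
  pr R A <= (#|X|)`!%:R / #|T|%:R ^+ #|X|.
Proof.
move=> /card_same_class_sizes; rewrite -(ler_nat R) !natrM natrX => le.
have T0 : 0 < #|T|%:R :> R by rewrite ltr0n.
have O0 : 0 < #|Omega|%:R :> R by rewrite ltr0n card_ffun expn_gt0 T_gt0.
by rewrite /pr ler_pdivrMr // mulrAC ler_pdivlMr ?exprn_gt0.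
Qed.

(* Markov's inequality for [(1 + x) ^+ class_size]. *)
Lemma pr_crowded_class D k q (x : R) : 0 <= x ->
  pr R [set f | (q < class_size f D k)%N] <=
    (1 + x / #|T|%:R) ^+ #|D| / (1 + x) ^+ q.
Proof.
move=> x0; have T0 : 0 < #|T|%:R :> R by rewrite ltr0n.
have O0 : 0 < #|Omega|%:R :> R by rewrite ltr0n card_ffun expn_gt0 T_gt0.
have x1 : 0 < 1 + x by lra.
rewrite /pr ler_pdivrMr // mulrAC ler_pdivlMr ?exprn_gt0 //.
pose w e t : R := if (e \in D) && (phi e t == k) then 1 + x else 1.
have wE f : (1 + x) ^+ class_size f D k = \prod_e w e (f e).
  rewrite -prodr_const big_mkcond; apply: eq_bigr => e _.
  by rewrite /w !inE.
apply: (@le_trans _ _ (\sum_(f : Omega) \prod_e w e (f e))).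
  rewrite mulr_natl -sumr_const [leRHS](bigID (mem [set f | (q < class_size f D k)%N])) /=.
  rewrite -[leLHS]addr0 lerD //.
    apply: ler_sum => f; rewrite inE -wE => lt_q.
    by rewrite ler_weXn2l ?lerDl // ltnW.
  apply: sumr_ge0 => f _; rewrite -wE exprn_ge0 //; exact: ltW.
rewrite -(bigA_distr_bigA w) /=.
(* The sum has factored over the edges. By injectivity of [phi e], at most one choice puts [e] into
   class [k], so a factor with [e] in [D] is at most [#|T| + x]. *)
apply: (@le_trans _ _ (\prod_e (#|T|%:R * (if e \in D then 1 + x / #|T|%:R else 1)))).
  apply: ler_prod => e _; apply/andP; split.
    by apply: sumr_ge0 => t _; rewrite /w; case: ifP => // _; exact: ltW.
  rewrite /w; case: (e \in D) => /=; last by rewrite sumr_const mulr1.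
  rewrite mulrDr mulr1 mulrC divfK ?gt_eqF //.
  have [t kt|nok] := pickP (fun t => phi e t == k).
    rewrite (bigD1 t) //= kt (eq_bigr (fun=> 1)) => [|t' nt]; last first.
      by rewrite -(eqP kt) (inj_eq (@phi_inj e)) (negPf nt).
    by rewrite sumr_const cardC1 -addrA [x + _]addrC addrA -mulrS prednK.
  rewrite (eq_bigr (fun=> 1)) ?sumr_const ?lerDl // => t _.
  by have := nok t; rewrite /= => ->.
rewrite big_split /= prodr_const -big_mkcond prodr_const /=.
by rewrite mulrC card_ffun natrX.
Qed.

End RandomClasses.

Lemma subset_of_card (T : finType) (Z : {set T}) n : (n <= #|Z|)%N ->
  exists2 X : {set T}, X \subset Z & #|X| = n.
Proof.
move=> le; exists [set z in take n (enum Z)].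
  by apply/subsetP => z; rewrite inE => /mem_take; rewrite mem_enum.
rewrite cardsE (card_uniqP _) ?take_uniq ?enum_uniq // size_take -cardE.
by move: le; rewrite leq_eqVlt => /predU1P[->|->] //; rewrite ltnn.
Qed.

Section ClassSize.
Variables (E T K : finType) (phi : E -> T -> K).
Implicit Types (f g : {ffun E -> T}) (D X : {set E}).

Lemma eq_class_size f g D k :
  {in D, f =1 g} -> class_size phi f D k = class_size phi g D k.
Proof.
move=> fg; apply: eq_card => e; rewrite !inE; case: (boolP (e \in D)) => //= eD.
by rewrite fg.
Qed.

Lemma class_sizeD f D X k : X \subset D ->
  class_size phi f D k = (class_size phi f X k + class_size phi f (D :\: X) k)%N.
Proof.
move=> sXD; rewrite /class_size -[LHS](cardsID X); congr (_ + _)%N.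
  apply: eq_card => e; rewrite !inE andbC andbA; case: (boolP (e \in X)) => //= eX.
  by rewrite (subsetP sXD).
by apply: eq_card => e; rewrite !inE andbA.
Qed.

End ClassSize.

(** * The local lemma applied to random classes of edges *)

Section RandomColouring.
Variables (R : realFieldType) (G : sgraph) (r N K : nat) (x : R).
Hypotheses (N_gt0 : (0 < N)%N) (K_gt0 : (0 < K)%N) (x_ge0 : 0 <= x).
Hypothesis mindegG : (r + 2 <= mindeg G)%N.

Let pfar : R := (r + 2)`!%:R / N%:R ^+ (r + 2).
Let padj : R := (r + 1)`!%:R / N%:R ^+ (r + 1).
Let pcrowd : R := (1 + x / N%:R) ^+ maxdeg G / (1 + x) ^+ K.-1.
Let D : R := (maxdeg G)%:R.

(** The dependency sum of the local lemma: a scope has at most [2 * D] edges. An edge is charged for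
    the pairs starting or ending at one of its two ends, hence the 4, and for [N.+2] crowding events
    at each end. *)
Hypothesis small :
  2 * D * (4 * (r%:R * D ^+ r * pfar + D * padj) + 2 * N.+2%:R * pcrowd) <= 4^-1.

Let maxdeg_gt0 (v : G) : (0 < maxdeg G)%N.
Proof. by apply: leq_trans (leq_maxdeg v); apply: leq_trans (mindeg_leq v); lia. Qed.

Variable cv : G -> 'I_N.+2 * 'I_K.
Hypothesis cv_proper : forall u v, adj u v -> cv u != cv v.

Let allowed (e : edge G) : {set 'I_N.+2} := ~: [set (cv v).1 | v in val e].

Let leq_allowed e : (N <= #|allowed e|)%N.
Proof.
have := cardsC [set (cv v).1 | v in val e]; rewrite card_ord -/(allowed e).
have := leq_imset_card (fun v => (cv v).1) (val e); rewrite card_edge.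
by move: #|_| #|_| => m n le2; rewrite -2!ltnS => <-; rewrite -[leqRHS]add2n leq_add2r.
Qed.

(** Keeps exactly [N] of the allowed classes, so that all edges choose uniformly from the same type
    ['I_N]. *)
Let phi (e : edge G) (t : 'I_N) : 'I_N.+2 := enum_val (widen_ord (leq_allowed e) t).

Let phi_inj e : injective (phi e).
Proof. by move=> s t /enum_val_inj /(congr1 val) /= /val_inj. Qed.

Let phi_allowed (e : edge G) t v : v \in val e -> phi e t != (cv v).1.
Proof.
move=> ve; have := enum_valP (widen_ord (leq_allowed e) t); rewrite -/(phi e t) inE.
by apply: contraNneq => ->; exact: imset_f.
Qed.

Let Event := ((G * G) + (G * 'I_N.+2))%type.

Let indistinct (u v : G) : {set {ffun edge G -> 'I_N}} :=
  [set f | [forall i, class_size phi f (incident u) i + ((cv u).1 == i) ==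
                      class_size phi f (incident v) i + ((cv v).1 == i)]]%N.

(** Pairs that are not [r]-neighbours get the impossible event, so that all pairs can serve as
    indices. *)
Let bad (a : Event) : {set {ffun edge G -> 'I_N}} :=
  match a with
  | inl (u, v) => if rneighbours r u v then indistinct u v else set0
  | inr (v, i) => [set f | (K.-1 < class_size phi f (incident v) i)%N]
  end.

Let scope (a : Event) : {set edge G} :=
  match a with
  | inl (u, v) => incident u :|: incident v
  | inr (v, i) => incident v
  end.

Let bad_determined a : determined_by (scope a) (bad a).
Proof.
case: a => [[u v]|[v i]] f g fg /=; last by rewrite !inE (@eq_class_size _ _ _ phi f g).
case: ifP => _; rewrite !inE //; apply: eq_forallb => i.
by rewrite !(@eq_class_size _ _ _ phi f g) // => e ev; apply: fg; rewrite /scope !inE in ev *; rewrite ev ?orbT.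
Qed.

(** Take [s] edges [X] at [u] but not at [v]. Fixing all other edges fixes the class sizes at [v]
    and those at [u] outside [X]; the event then prescribes the class sizes on [X]. *)
Let pr_indistinct u v s : u != v -> (s <= #|incident u :\: incident v|)%N ->
  pr R (indistinct u v) <= s`!%:R / N%:R ^+ s.
Proof.
move=> uv /subset_of_card[X sX <-].
rewrite -{2}[N]card_ord; apply: (@pr_same_class_sizes R _ _ _ phi); rewrite ?card_ord //.
have sXu : X \subset incident u by apply: subset_trans sX (subsetDl _ _).
move=> f g; rewrite !inE => /forallP fu /forallP gu fg k.
have := eqP (fu k); have := eqP (gu k); rewrite !(class_sizeD phi _ k sXu).
rewrite (@eq_class_size _ _ _ phi f g (incident u :\: X)).
  rewrite (@eq_class_size _ _ _ phi f g (incident v)); first by lia.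
  move=> e ev; apply: fg; rewrite inE; apply: contraL ev => /(subsetP sX).
  by rewrite inE => /andP[].
by move=> e; rewrite inE => /andP[eX _]; apply: fg; rewrite inE.
Qed.

(** Adjacent [r]-neighbours are charged both terms, so that the sum over [v] splits in two. *)
Let bound (a : Event) : R :=
  match a with
  | inl (u, v) => (within_dist r u v)%:R * pfar + (adj u v)%:R * padj
  | inr _ => pcrowd
  end.

Let pfar_ge0 : 0 <= pfar.
Proof. by rewrite divr_ge0 ?exprn_ge0 ?ler0n. Qed.

Let padj_ge0 : 0 <= padj.
Proof. by rewrite divr_ge0 ?exprn_ge0 ?ler0n. Qed.

Let pcrowd_ge0 : 0 <= pcrowd.
Proof. by rewrite divr_ge0 ?exprn_ge0 // addr_ge0 // divr_ge0 ?ler0n. Qed.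

Let bound_ge0 a : 0 <= bound a.
Proof.
by case: a => [[u v]|[v i]] //=; rewrite addr_ge0 // mulr_ge0 ?ler0n.
Qed.

Let pr_bad a : pr R (bad a) <= bound a.
Proof.
case: a => [[u v]|[v i]] /=; last first.
  apply: le_trans (pr_crowded_class _ phi_inj _ _ _ x_ge0) _; rewrite ?card_ord //.
  rewrite ler_wpM2r ?invr_ge0 ?exprn_ge0 ?addr_ge0 // card_incident.
  by rewrite ler_weXn2l ?leq_maxdeg // lerDl divr_ge0 ?ler0n.
case: ifP => [/rneighbours_within_dist[uv ->]|_]; last first.
  by rewrite /pr cards0 mul0r; exact: (bound_ge0 (inl (u, v))).
(* Of the at least [r + 2] edges at [u], only an edge joining [u] to [v] is lost. *)
have := card_incident2 uv; have := cardsID (incident v) (incident u).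
rewrite card_incident; have := leq_trans mindegG (mindeg_leq u).
case: (adj u v) => /= ledeg sumE le1.
  rewrite !mul1r; apply: (@le_trans _ _ padj); last by rewrite lerDr.
  apply: pr_indistinct => //; move: sumE le1 ledeg; move: #|_ :&: _| #|_ :\: _| (deg u) => a b d; lia.
rewrite mul1r mul0r addr0; apply: pr_indistinct => //.
move: sumE le1 ledeg; move: #|_ :&: _| #|_ :\: _| (deg u) => a b d; lia.
Qed.

Let sum_within_adj (u : G) :
  \sum_(v : G) ((within_dist r u v)%:R * pfar + (adj u v)%:R * padj) <=
  r%:R * D ^+ r * pfar + D * padj.
Proof.
have cardE (P : pred G) : \sum_(v : G) (P v)%:R = #|[set v | P v]|%:R :> R.
  rewrite -sum1_card natr_sum [RHS]big_mkcond; apply: eq_bigr => v _.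
  by rewrite inE; case: (P v).
rewrite big_split -!mulr_suml !cardE; apply: lerD; apply: ler_wpM2r => //.
  by rewrite -natrX -natrM ler_nat card_within_dist ?(maxdeg_gt0 u).
by rewrite ler_nat; exact: leq_maxdeg.
Qed.

Let sum_bound_edge (e : edge G) :
  \sum_(a | e \in scope a) bound a <=
  4 * (r%:R * D ^+ r * pfar + D * padj) + 2 * N.+2%:R * pcrowd.
Proof.
set a0 := _ + D * padj.
have sum_ends (F : G -> R) c : (forall v, F v <= c) ->
    \sum_(v : G) (v \in val e)%:R * F v <= 2 * c.
  move=> Fc; rewrite (_ : 2 * c = \sum_(v in val e) c).
    rewrite [leRHS]big_mkcond; apply: ler_sum => v _.
    by case: ifP => _; rewrite ?mul0r // mul1r.
  by rewrite sumr_const card_edge mulr_natl.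
rewrite big_mkcond big_sumType /=; apply: lerD.
  rewrite (eq_bigr (fun p : G * G => if e \in incident p.1 :|: incident p.2 then
    (within_dist r p.1 p.2)%:R * pfar + (adj p.1 p.2)%:R * padj else 0)); last by case.
  rewrite -(pair_bigA _ (fun u v => if e \in incident u :|: incident v then
    (within_dist r u v)%:R * pfar + (adj u v)%:R * padj else 0)) /=.
  pose F (u v : G) : R := (within_dist r u v)%:R * pfar + (adj u v)%:R * padj.
  have F0 u v : 0 <= F u v by exact: (bound_ge0 (inl (u, v))).
  (* A pair is charged once for each coordinate that is an end of [e]; as [F] is symmetric, both
     charges have the same total. *)
  apply: (@le_trans _ _ (\sum_(u : G) \sum_(v : G) ((u \in val e)%:R * F u v + (v \in val e)%:R * F v u))).
    apply: ler_sum => u _; apply: ler_sum => v _; rewrite !inE.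
    have -> : F v u = F u v by rewrite /F within_dist_sym adj_sym.
    rewrite -/(F u v); have := F0 u v.
    by case: (u \in val e); case: (v \in val e) => /=; lra.
  under eq_bigr do rewrite big_split /=.
  rewrite big_split /= (_ : 4 * a0 = 2 * a0 + 2 * a0); last by lra.
  apply: lerD; last rewrite exchange_big /=; under eq_bigr do rewrite -mulr_sumr;
    exact: (sum_ends (fun u => \sum_(v : G) F u v) _ sum_within_adj).
rewrite (eq_bigr (fun p : G * 'I_N.+2 => if e \in incident p.1 then pcrowd else 0));
  last by case.
rewrite -(pair_bigA _ (fun v (_ : 'I_N.+2) => if e \in incident v then pcrowd else 0)) /=.
rewrite -mulrA; apply: le_trans (sum_ends (fun=> N.+2%:R * pcrowd) _ _) => //.
apply: ler_sum => v _; rewrite sumr_const card_ord inE [N.+2%:R * _]mulr_natl.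
by case: (v \in val e); rewrite ?mul1r ?mul0r ?mul0rn.
Qed.

Let card_scope a : (#|scope a| <= 2 * maxdeg G)%N.
Proof.
have le (v : G) : (#|incident v| <= maxdeg G)%N.
  by rewrite card_incident; exact: leq_maxdeg.
rewrite mul2n -addnn; case: a => [[u v]|[v i]] /=.
  by rewrite cardsU; apply: leq_trans (leq_subr _ _) _; rewrite leq_add.
by apply: leq_trans (le v) _; rewrite leq_addr.
Qed.

(** Scopes that meet share an edge, so a sum over the edges of [scope a] counts every dependent
    event at least once. *)
Let sum_bad a : \sum_(b | ~~ [disjoint scope a & scope b]) pr R (bad b) <= 4^-1.
Proof.
apply: le_trans small.
apply: (@le_trans _ _ (\sum_(e in scope a) \sum_(b | e \in scope b) bound b)).
  under [leRHS]eq_bigr do rewrite big_mkcond.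
  rewrite exchange_big [leLHS]big_mkcond /=; apply: ler_sum => b _.
  case: ifPn => [/pred0Pn[e /andP[ea eb]]|_]; last first.
    by apply: sumr_ge0 => e _; case: ifP.
  apply: le_trans (pr_bad b) _; rewrite (bigD1 e) //= (eb : e \in scope b) lerDl.
  by apply: sumr_ge0 => f _; case: ifP.
apply: le_trans (ler_sum _ (fun e _ => sum_bound_edge e)) _.
rewrite sumr_const -[leLHS]mulr_natl ler_wpM2r //.
  apply: addr_ge0; last by apply: mulr_ge0 => //; apply: mulr_ge0.
  have D0 : 0 <= D by exact: ler0n.
  apply: mulr_ge0 => //; apply: addr_ge0; apply: mulr_ge0 => //.
  by apply: mulr_ge0 => //; exact: exprn_ge0.
by rewrite -natrM ler_nat card_scope.
Qed.

(** An event with nonempty scope is among its own dependent events, so [sum_bad] also bounds its own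
    probability by 1/4. *)
Let scope_neq0 a : exists e, e \in scope a.
Proof.
have inc (v : G) : exists e, e \in incident v.
  apply/set0Pn; rewrite -card_gt0 card_incident.
  by apply: leq_trans (leq_trans _ mindegG) (mindeg_leq v); rewrite addn2.
by case: a => [[u v]|[v i]] /=; [have [e eu] := inc u; exists e; rewrite inE eu | exact: inc].
Qed.

Lemma chi_total_le_random_classes : (chi_total G r <= N.+2 * K)%N.
Proof.
have [|a|f fP] := local_lemma (R := R) (A := bad) (S := scope) _ bad_determined _ sum_bad.
- by rewrite card_ord.
- have [e ea] := scope_neq0 a; apply: le_trans (sum_bad a).
  rewrite (bigD1 a) /= ?lerDl; last by apply/pred0Pn; exists e; rewrite /= ea.
  by apply: sumr_ge0 => b _; rewrite divr_ge0 ?ler0n.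
apply: (@chi_total_le_classes _ _ _ _ (fun e => phi e (f e)) cv) => //.
- by move=> e v; rewrite inE; exact: phi_allowed.
- move=> v i; have := fP (inr (v, i)); rewrite /= inE -leqNgt -ltnS prednK //.
- move=> u v uv; have := fP (inl (u, v)); rewrite /= uv inE => /forallPn[i ne].
  by exists i.
Qed.

End RandomColouring.

(** * Asymptotics *)

Section Numerics.
Variable R : realType.
Implicit Types (c L x y : R) (n r : nat).

(** [expR y] is the [n.+1]-st power of [expR (y / n.+1)], which is at least [y / n.+1]. *)
Lemma expR_ge_poly c n y :
  0 <= y -> c * n.+1%:R ^+ n.+1 <= y -> c * y ^+ n <= expR y.
Proof.
move=> y0 cy; have n0 : 0 < n.+1%:R :> R by rewrite ltr0n.
rewrite -[y in expR y](divfK (lt0r_neq0 n0)) [X in expR X]mulrC expRM_natl.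
apply: (@le_trans _ _ ((y / n.+1%:R) ^+ n.+1)); last first.
  apply: lerXn2r; rewrite ?nnegrE ?expR_ge0 ?divr_ge0 ?ler0n //.
  by apply: le_trans (expR_ge1Dx _); rewrite lerDr.
rewrite expr_div_n ler_pdivlMr ?exprn_gt0 // [y ^+ _.+1]exprS [leLHS]mulrAC.
by rewrite ler_wpM2r ?exprn_ge0.
Qed.

Lemma near_ln_ge c : \forall D \near \oo%classic, c <= ln (D%:R : R).
Proof.
near=> D.
have le : expR c <= D%:R by near: D; exact: nbhs_infty_ger.
have D0 : 0 < D%:R :> R by apply: lt_le_trans le; exact: expR_gt0.
by rewrite -[c]expRK ler_ln // posrE expR_gt0.
Unshelve. all: by end_near. Qed.

Lemma near_polylog c n : \forall D \near \oo%classic, c * ln (D%:R : R) ^+ n <= D%:R.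
Proof.
near=> D.
have D0 : 0 < D%:R :> R by rewrite ltr0n; near: D; exact: nbhs_infty_gt.
rewrite -[leRHS]lnK ?posrE //; apply: expR_ge_poly; near: D; exact: near_ln_ge.
Unshelve. all: by end_near. Qed.


(** With [x = 1 / L] the numerator is at most the exponential of [(L^4 + 1) / L], about [L^3], and
    the denominator at least that of [(L^4 + 5 L^3 + 1) / (L + 1)], about [L^3 + 4 L^2]. The gain
    exceeds [3 L], and [d^-3] is [expR (- 3 L)]. *)
Lemma crowd_probability_le (d q : nat) (n L : R) :
    3 <= L -> expR L = d%:R -> 0 < n -> d%:R <= (L ^+ 4 + 1) * n ->
    L ^+ 4 + 5 * L ^+ 3 + 1 <= q%:R ->
  (1 + L^-1 / n) ^+ d / (1 + L^-1) ^+ q <= d%:R ^- 3.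
Proof.
move=> L3 dE n0 dn Lq.
have L0 : 0 < L by lra.
have Li0 : 0 < L^-1 by rewrite invr_gt0.
have up : (1 + L^-1 / n) ^+ d <= expR ((L ^+ 4 + 1) / L).
  apply: (@le_trans _ _ (expR (d%:R * (L^-1 / n)))).
    rewrite expRM_natl lerXn2r ?nnegrE ?expR_ge0 ?expR_ge1Dx //.
    by rewrite addr_ge0 // divr_ge0 // ltW.
  rewrite ler_expR mulrCA [leRHS]mulrC ler_wpM2l ?(ltW Li0) //.
  by rewrite ler_pdivrMr.
have low : expR ((L ^+ 4 + 5 * L ^+ 3 + 1) / (L + 1)) <= (1 + L^-1) ^+ q.
  apply: (@le_trans _ _ (expR (q%:R * (L + 1)^-1))).
    by rewrite ler_expR ler_wpM2r // invr_ge0; lra.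
  rewrite expRM_natl lerXn2r ?nnegrE ?expR_ge0 //; first lra.
  (* [1 + 1 / L] is the inverse of [1 - 1 / (L + 1)], hence at least [expR (1 / (L + 1))]. *)
  rewrite -[expR _]invrK -expRN -[1 + _]invrK lef_pV2 ?posrE ?expR_gt0 ?invr_gt0 //; last lra.
  apply: le_trans (expR_ge1Dx _).
  by rewrite [leLHS](_ : _ = 1 - (L + 1)^-1) //; field; rewrite !gt_eqF //; lra.
rewrite -dE -expRM_natl -expRN ler_pdivrMr ?exprn_gt0 //; last by lra.
apply: le_trans up _.
apply: (@le_trans _ _ (expR (- (3%:R * L)) * expR ((L ^+ 4 + 5 * L ^+ 3 + 1) / (L + 1)))); last first.
  by rewrite ler_wpM2l // expR_ge0.
rewrite -expRD ler_expR -subr_ge0.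
have -> : - (3%:R * L) + (L ^+ 4 + 5 * L ^+ 3 + 1) / (L + 1) - (L ^+ 4 + 1) / L =
    (4 * L ^+ 4 - 1 - 3 * L ^+ 3 - 3 * L ^+ 2) / (L * (L + 1)).
  by field; rewrite !gt_eqF //; lra.
apply: divr_ge0; last by apply: mulr_ge0; lra.
have L2 : 9 <= L ^+ 2 by nra.
have L3' : 3 * L ^+ 2 <= L ^+ 3 by rewrite exprSr; nra.
have L4 : 3 * L ^+ 3 <= L ^+ 4 by rewrite [L ^+ 4]exprSr; nra.
by lra.
Qed.

(** As [N] is at least [D / (2 L^4)], the three contributions are a power of [L] over [D], a power
    of [L] over [D^(r-1)], and [4 / D]. For large [D] each is at most 1/12. *)
Lemma local_lemma_condition r : (2 <= r)%N -> \forall D \near \oo%classic,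
  let L := ln (D%:R : R) in forall N K : nat,
  D%:R / L ^+ 4 <= N.+2%:R -> N.+2%:R <= D%:R / L ^+ 4 + 1 ->
  L ^+ 4 + 5 * L ^+ 3 + 2 <= K%:R ->
  [/\ (0 < N)%N, (0 < K)%N, (D < N.+2 * K)%N, 0 <= L^-1 &
   2 * D%:R * (4 * (r%:R * D%:R ^+ r * ((r + 2)`!%:R / N%:R ^+ (r + 2)) +
                    D%:R * ((r + 1)`!%:R / N%:R ^+ (r + 1))) +
      2 * N.+2%:R * ((1 + L^-1 / N%:R) ^+ D / (1 + L^-1) ^+ K.-1)) <= 4^-1].
Proof.
move=> r2; near=> D.
pose C1 : R := 8 * r%:R * (r + 2)`!%:R * 2 ^+ (r + 2).
pose C2 : R := 8 * (r + 1)`!%:R * 2 ^+ (r + 1).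
have d0 : 0 < D%:R :> R by rewrite ltr0n; near: D; exact: nbhs_infty_gt.
have L3 : 3 <= ln (D%:R : R) by near: D; exact: near_ln_ge.
have dC1 : 12 * C1 * ln (D%:R : R) ^+ (4 * (r + 2)) <= D%:R by near: D; exact: near_polylog.
have dC2 : 12 * C2 * ln (D%:R : R) ^+ (4 * (r + 1)) <= D%:R by near: D; exact: near_polylog.
have d48 : 48 * ln (D%:R : R) ^+ 0 <= D%:R by near: D; exact: near_polylog.
have d8 : 4 * ln (D%:R : R) ^+ 8 <= D%:R by near: D; exact: near_polylog.
set L := ln D%:R in L3 dC1 dC2 d48 d8 *; set d : R := D%:R in d0 dC1 dC2 d48 d8 *.
move=> N K mlo mhi kge.
have L2 : 9 <= L ^+ 2 by nra.
have L4 : 81 <= L ^+ 4 by rewrite (exprM L 2 2); nra.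
have L8 : 81 * L ^+ 4 <= L ^+ 8 by rewrite (exprM L 4 2); nra.
have L4_0 : 0 < L ^+ 4 by lra.
have L0 : 0 < L by lra.
have L3_0 : 0 < L ^+ 3 by rewrite exprn_gt0 //; lra.
set y := d / L ^+ 4 in mlo mhi.
have dE : d = y * L ^+ 4 by rewrite divfK ?lt0r_neq0.
(* Gives [2 L^4 + 2 <= y], so the loss of two classes only raises the mean class size to at most
   [L^4 + 1], that is, [d <= (L^4 + 1) * N]. *)
have y4 : 4 * L ^+ 4 <= y.
  by rewrite ler_pdivlMr // -mulrA -exprD.
have nE : N.+2%:R = N%:R + 2 :> R by rewrite -addn2 natrD.
rewrite nE in mlo mhi.
have n0 : 0 < N%:R :> R by lra.
have n_half : y / 2 <= N%:R by lra.
have Kpos : (0 < K)%N by rewrite -(ltr0n R); lra.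
have K1 : K.-1%:R = K%:R - 1 :> R by rewrite -[in RHS](prednK Kpos) -natr1 addrK.
split=> //.
- by rewrite -(ltr0n R).
- rewrite -(ltr_nat R) natrM nE -/d dE; nra.
- by rewrite invr_ge0; lra.
have crowd : (1 + L^-1 / N%:R) ^+ D / (1 + L^-1) ^+ K.-1 <= d ^- 3.
  apply: crowd_probability_le => //; first by rewrite lnK // posrE.
    rewrite -/d dE; nra.
  by rewrite K1; lra.
have ninv : N%:R^-1 <= 2 * L ^+ 4 / d.
  rewrite -[leRHS]invrK lef_pV2 ?posrE ?invr_gt0 ?divr_gt0 ?mulr_gt0 //.
  by rewrite invf_div; move: n_half; rewrite /y -mulrA -invfM [L ^+ 4 * 2]mulrC.
have frac s : (s`!%:R / N%:R ^+ s : R) <= s`!%:R * (2 ^+ s * L ^+ (4 * s) / d ^+ s).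
  rewrite ler_wpM2l ?ler0n // -exprVn exprM -exprMn -expr_div_n.
  by apply: lerXn2r; rewrite ?nnegrE ?invr_ge0 ?divr_ge0 ?mulr_ge0 ?ler0n // ltW.
have dn0 : d != 0 by rewrite lt0r_neq0.
have t1 : 8 * d * (r%:R * d ^+ r * ((r + 2)`!%:R / N%:R ^+ (r + 2))) <= 12^-1.
  apply: (@le_trans _ _ (8 * d * (r%:R * d ^+ r *
      ((r + 2)`!%:R * (2 ^+ (r + 2) * L ^+ (4 * (r + 2)) / d ^+ (r + 2)))))).
    do 2!(apply: ler_wpM2l; first by rewrite !mulr_ge0 ?exprn_ge0 // ltW).
    exact: frac.
  rewrite [leLHS](_ : _ = C1 * L ^+ (4 * (r + 2)) / d).
    by rewrite ler_pdivrMr //; lra.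
  by rewrite /C1 (addn2 r) !(exprS d); field; rewrite dn0 expf_neq0.
have t2 : 8 * d * (d * ((r + 1)`!%:R / N%:R ^+ (r + 1))) <= 12^-1.
  apply: (@le_trans _ _ (8 * d * (d *
      ((r + 1)`!%:R * (2 ^+ (r + 1) * L ^+ (4 * (r + 1)) / d ^+ (r + 1)))))).
    do 2!(apply: ler_wpM2l; first by rewrite ?mulr_ge0 // ltW).
    exact: frac.
  rewrite [leLHS](_ : _ = C2 * L ^+ (4 * (r + 1)) / d ^+ r.-1).
    (* Here [2 <= r] enters: [d] is at most [d^(r-1)]. *)
    apply: (@le_trans _ _ (C2 * L ^+ (4 * (r + 1)) / d)); last first.
      by rewrite ler_pdivrMr //; lra.
    apply: ler_wpM2l; first by rewrite !mulr_ge0 ?exprn_ge0 ?ler0n //; lra.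
    rewrite lef_pV2 ?posrE ?exprn_gt0 // ler_eXnr //; last lra.
    by case: (r) r2 => [|[]].
  have -> : d ^+ (r + 1) = d * d * d ^+ r.-1.
    have -> : (r + 1)%N = r.-1.+2 by case: (r) r2 => // p _; rewrite addn1.
    by rewrite !exprS mulrA.
  by rewrite /C2; field; rewrite dn0 expf_neq0.
have t3 : 4 * d * (N.+2%:R * ((1 + L^-1 / N%:R) ^+ D / (1 + L^-1) ^+ K.-1)) <= 12^-1.
  apply: (@le_trans _ _ (4 * d * (d * d ^- 3))).
    apply: ler_wpM2l; first by rewrite mulr_ge0 // ltW.
    apply: ler_pM; rewrite ?ler0n //.
      by rewrite divr_ge0 ?exprn_ge0 ?addr_ge0 ?divr_ge0 ?invr_ge0 //; lra.
    by rewrite nE dE; nra.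
  rewrite [leLHS](_ : _ = 4 / d); last by field.
  by rewrite ler_pdivrMr //; lra.
have -> : 4^-1 = 12^-1 + 12^-1 + 12^-1 :> R by lra.
apply: le_trans (lerD (lerD t1 t2) t3).
by rewrite le_eqVlt; apply/orP; left; apply/eqP; ring.
Unshelve. all: by end_near. Qed.

(** The constant 8 is 2 plus the rounding errors 1 and 5 of the ceilings. The product expands to at
    most [d + 13 d / L + 14 L^4], and each of the last two terms is at most [eps / 2 * d]. *)
Lemma asymptotic_ratio (eps : R) : 0 < eps -> \forall D \near \oo%classic,
  let L := ln (D%:R : R) in forall m k : R,
  0 <= k -> m <= D%:R / L ^+ 4 + 1 -> k <= L ^+ 4 + 5 * L ^+ 3 + 8 ->
  m * k <= (1 + eps) * D%:R.
Proof.
move=> eps0; near=> D.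
have L1 : 1 <= ln (D%:R : R) by near: D; exact: near_ln_ge.
have Leps : 26 / eps <= ln (D%:R : R) by near: D; exact: near_ln_ge.
have d4 : 28 / eps * ln (D%:R : R) ^+ 4 <= D%:R by near: D; exact: near_polylog.
set L := ln D%:R in L1 Leps d4 *; set d : R := D%:R in d4 *.
move=> m k k0 mle kle.
have L0 : 0 < L by lra.
have d_ge0 : 0 <= d by exact: ler0n.
have L3 : 1 <= L ^+ 3 by rewrite exprn_ege1.
have L43 : L ^+ 3 <= L ^+ 4 by rewrite [L ^+ 4]exprSr ler_peMr //; lra.
apply: (@le_trans _ _ ((d / L ^+ 4 + 1) * (L ^+ 4 + 5 * L ^+ 3 + 8))).
  apply: (@le_trans _ _ ((d / L ^+ 4 + 1) * k)); first by rewrite ler_wpM2r.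
  by rewrite ler_wpM2l // addr_ge0 // divr_ge0 // exprn_ge0; lra.
have y0 : 0 <= d / L ^+ 4 by rewrite divr_ge0 // exprn_ge0; lra.
have dE : d / L ^+ 4 * L ^+ 3 = d / L by field; lra.
have dE4 : d / L ^+ 4 * L ^+ 4 = d by rewrite divfK // expf_neq0 //; lra.
have h1 : d / L ^+ 4 <= d / L by rewrite -dE ler_peMr.
have h2 : 13 * (d / L) <= eps / 2 * d.
  move: Leps; rewrite ler_pdivrMr // => Leps.
  by rewrite mulrCA mulrC ler_wpM2r // ler_pdivrMr //; lra.
have h3 : 14 * L ^+ 4 <= eps / 2 * d.
  by move: d4; rewrite mulrAC ler_pdivrMr //; lra.
lra.
Unshelve. all: by end_near. Qed.

End Numerics.

(** * The upper bound with ceilings and its asymptotic form *)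

Lemma chi_total_le_ceil (R : realType) r : (2 <= r)%N -> \forall D \near \oo%classic,
  forall G : sgraph, maxdeg G = D -> (r + 2 <= mindeg G)%N ->
  let L : R := ln D%:R in
  (chi_total G r)%:Z <=
    Num.ceil (D%:R / L ^+ 4) * (Num.ceil (L ^+ 4) + 5 * Num.ceil (L ^+ 3) + 2).
Proof.
move=> r2; move: (near_ln_ge (1 : R)) (near_polylog (2 : R) 4) (local_lemma_condition R r2).
apply: filterS3 => D + + + G GD degG; set L := ln _ => L1 d2 num.
have L4 : 1 <= L ^+ 4 by rewrite exprn_ege1.
have L3 : 1 <= L ^+ 3 by rewrite exprn_ege1.
(* At least two classes, so that their number has the form [N.+2]. *)
have M1 : 1 < Num.ceil (D%:R / L ^+ 4).
  by rewrite ceil_gt_int ltr_pdivlMr ?(lt_le_trans ltr01) //; move: d2; rewrite -/L; lra.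
have C4 := ceil_ge (L ^+ 4); have C3 := ceil_ge (L ^+ 3).
have C4' : 0 <= Num.ceil (L ^+ 4) by rewrite ceil_ge0; lra.
have C3' : 0 <= Num.ceil (L ^+ 3) by rewrite ceil_ge0; lra.
have [N NE] : exists N : nat, Num.ceil (D%:R / L ^+ 4) = N.+2 :> int.
  by case: (Num.ceil _) M1 => [[|[|N]]|] // _; exists N.
have [K KE] : exists K : nat, Num.ceil (L ^+ 4) + 5 * Num.ceil (L ^+ 3) + 2 = K :> int.
  exists (absz (Num.ceil (L ^+ 4) + 5 * Num.ceil (L ^+ 3) + 2)).
  by rewrite gez0_abs //; lia.
have [|||N0 K0 DM x0 small] := num N K.
- by have := ceil_ge (D%:R / L ^+ 4); rewrite NE.
- by have := ceilB1_lt (D%:R / L ^+ 4); rewrite NE intrB /=; rewrite -/L; lra.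
- have : (Num.ceil (L ^+ 4) + 5 * Num.ceil (L ^+ 3) + 2)%:~R = K%:R :> R by rewrite KE.
  by rewrite !intrD intrM => <-; rewrite -/L; lra.
rewrite NE KE -PoszM lez_nat.
have [cv cvP] : exists cv : G -> 'I_N.+2 * 'I_K, forall u v, adj u v -> cv u != cv v.
  by apply: vertex_colouring; rewrite card_prod !card_ord GD.
by apply: (chi_total_le_random_classes N0 K0 x0 degG _ cvP); rewrite GD.
Qed.

Theorem theorem8 (R : realType) (r : nat) (hr : (2 <= r)%N) :
  (exists Delta0 : nat, forall G : sgraph,
     (Delta0 <= maxdeg G)%N -> (r + 2 <= mindeg G)%N ->
     let L : R := ln (maxdeg G)%:R in
     (chi_total G r)%:Z <=
       Num.ceil ((maxdeg G)%:R / L ^+ 4) *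
       (Num.ceil (L ^+ 4) + 5 * Num.ceil (L ^+ 3) + 2))
  /\
  (exists o : sgraph -> R,
     (forall G : sgraph, (r + 2 <= mindeg G)%N ->
        (chi_total G r)%:R = (1 + o G) * (maxdeg G)%:R) /\
     (forall eps : R, 0 < eps ->
        exists Delta1 : nat, forall G : sgraph,
          (Delta1 <= maxdeg G)%N -> (r + 2 <= mindeg G)%N ->
          `|o G| <= eps)).
Proof.
have [D0 _ chi_le] := chi_total_le_ceil R hr.
split; first by exists D0 => G GD degG; apply: chi_le.
have maxdeg_gt0 (G : sgraph) : (r + 2 <= mindeg G)%N -> 0 < (maxdeg G)%:R :> R.
  move=> degG; rewrite ltr0n.
  (* The graph without vertices has minimum degree 0, which the degree hypothesis excludes. *)
  case: (pickP (fun _ : G => true)) => [v _|G0].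
    apply: leq_trans (leq_trans (mindeg_leq v) (leq_maxdeg v)).
    by apply: leq_trans degG; rewrite addn2.
  by move: degG; rewrite /mindeg big_pred0 // (eq_card0 G0) addn2.
(* The relative error; it is nonnegative by [maxdeg_le_chi_total], so only the upper bound remains
   to be estimated. *)
exists (fun G => (chi_total G r)%:R / (maxdeg G)%:R - 1); split=> [G degG|eps eps0].
  by rewrite addrC subrK divfK // lt0r_neq0 // maxdeg_gt0.
have [D1 _ ratio] := asymptotic_ratio eps0.
exists (maxn D0 D1) => G; rewrite geq_max => /andP[GD0 GD1] degG.
have d0 := maxdeg_gt0 G degG.
have lo : 1 <= (chi_total G r)%:R / (maxdeg G)%:R :> R.
  by rewrite ler_pdivlMr // mul1r ler_nat maxdeg_le_chi_total.
rewrite ger0_norm; last by rewrite subr_ge0.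
rewrite lerBlDl ler_pdivrMr //.
have := chi_le _ GD0 G erefl degG; rewrite -(ler_int R) intrM => /le_trans; apply.
set L := ln _.
have C4 := ceilB1_lt (L ^+ 4); have C3 := ceilB1_lt (L ^+ 3).
rewrite !intrB in C4 C3; apply: (ratio _ GD1).
- have L0 : 0 <= L by rewrite ln_ge0 // ler1n -(ltr0n R).
  have C4' : 0 <= Num.ceil (L ^+ 4) by rewrite ceil_ge0 (lt_le_trans _ (exprn_ge0 _ L0)).
  have C3' : 0 <= Num.ceil (L ^+ 3) by rewrite ceil_ge0 (lt_le_trans _ (exprn_ge0 _ L0)).
  by rewrite ler0z; lia.
- by have := ceilB1_lt ((maxdeg G)%:R / L ^+ 4); rewrite intrB; lra.
- by rewrite !intrD intrM -/L; lra.
Qed.
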